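(* Let $T$ be a tree that is not the path $P_3$ on three vertices. Then $T$ is $[1,2]$-semiexcellent if and only if $T$ has no strong support vertices.
   Context: All graphs are finite, undirected and simple; trees are connected. For a graph $G=(V,E)$ and $v\in V$, $N(v)$ is the set of neighbors of $v$. A set $S\subseteq V$ is an independent $[1,2]$-set of $G$ if no two vertices of $S$ are adjacent and every vertex $v\in V\setminus S$ satisfies $1\le |N(v)\cap S|\le 2$. A graph $G$ is $[1,2]$-semiexcellent if every vertex of $G$ belongs to some independent $[1,2]$-set of $G$ (not necessarily of minimum cardinality). A leaf is a vertex of degree $1$. A strong support vertex is a vertex having at least two leaves in its neighborhood. *)

(* Defs.v *)
From mathcomp Require Import all_boot.

Set Implicit Arguments.
Unset Strict Implicit.
Unset Printing Implicit Defensive.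

Record sgraph := SGraph {
  vertex :> finType;
  adj : rel vertex;
  adj_sym : symmetric adj;
  adj_irrefl : irreflexive adj
}.

Definition graph_iso (G H : sgraph) : Prop :=
  exists2 f : G -> H, bijective f & {mono f : x y / adj x y}.

Definition path_adj (n : nat) : rel 'I_n :=
  [rel i j : 'I_n | (i.+1 == j :> nat) || (j.+1 == i :> nat)].

Lemma path_adj_sym n : symmetric (@path_adj n).
Proof. by move=> i j; rewrite /path_adj /= orbC. Qed.

Lemma path_adj_irrefl n : irreflexive (@path_adj n).
Proof. by move=> i; rewrite /path_adj /= orbb; apply/negbTE; rewrite gtn_eqF. Qed.

Definition path_graph (n : nat) : sgraph :=
  SGraph (@path_adj_sym n) (@path_adj_irrefl n).

Section Graph.
Variable G : sgraph.

Definition connected : Prop := 0 < #|G| /\ forall x y : G, connect (@adj G) x y.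

(* The bound on the size is needed: [:: x; y] is a [ucycle] for every edge. *)
Definition acyclic : Prop :=
  forall c : seq G, 2 < size c -> ~ ucycle (@adj G) c.

Definition tree : Prop := connected /\ acyclic.

Definition neigh (v : G) : {set G} := [set u | adj v u].

Definition independent (S : {set G}) : Prop :=
  {in S &, forall u v, ~~ adj u v}.

Definition independent12 (S : {set G}) : Prop :=
  independent S /\ forall v, v \notin S -> 1 <= #|neigh v :&: S| <= 2.

Definition semiexcellent12 : Prop :=
  forall v : G, exists2 S : {set G}, independent12 S & v \in S.

Definition leaf (v : G) : bool := #|neigh v| == 1.

Definition strong_support (v : G) : bool :=
  2 <= #|[set u in neigh v | leaf u]|.

End Graph.

(* Main.v *)
Require Import Defs.
From mathcomp Require Import all_boot.

(** Rooting the tree reduces both directions to local counting.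

    Suppose that [v] is a strong support vertex, with leaves [a] and [b].  Since
    [T] is not the path on three vertices and is connected, [v] has a third
    neighbour [w].  An independent [1,2]-set containing [w] misses [v], so it
    can only dominate [a] and [b] by containing them; then [v] has three
    neighbours in it, a contradiction.

    Conversely, suppose that no vertex is a strong support vertex, and root the
    tree at a prescribed vertex [r] ([tree_parent]).  Each vertex [u] having
    children selects one of them, its leaf child if there is one.  Going down
    from the root, put [r] in [S], and put any other vertex in [S] exactly when
    it is selected by its parent and its parent is not in [S]
    ([parent_recursion]).  Then
    - [S] is independent, as every edge joins a vertex to its parent;
    - a vertex outside [S] has at most two neighbours in [S], namely its parent
      and its selected child;
    - a leaf outside [S] has its parent in [S]: it is the only leaf child of its
      parent, hence is selected, so only its parent can have kept it out;
    - any other vertex outside [S] has children, and its selected child is in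
      [S]. *)

Set Implicit Arguments.
Unset Strict Implicit.
Unset Printing Implicit Defensive.

Lemma leaf_neigh_uniq (G : sgraph) (u x y : G) :
  leaf u -> adj u x -> adj u y -> x = y.
Proof.
move=> /cards1P[z uz] ux uy.
have: x \in neigh u by rewrite inE.
have: y \in neigh u by rewrite inE.
by rewrite uz !inE => /eqP-> /eqP->.
Qed.

Lemma not_strong_support_leaf_uniq (G : sgraph) (v x y : G) :
  ~~ strong_support v -> adj v x -> adj v y -> leaf x -> leaf y -> x = y.
Proof.
rewrite /strong_support -ltnNge ltnS => /card_le1_eqP le1 vx vy lx ly.
by apply: le1; rewrite !inE ?vx ?vy.
Qed.

(** The ends of a path with two edges, with no further neighbour at the centre,
    are leaves, so connectedness leaves no room for other vertices. *)
Lemma path3_of_two_leaves (G : sgraph) (v a b : G) :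
    connected G -> a != b -> adj v a -> adj v b -> leaf a -> leaf b ->
    neigh v \subset [set a; b] -> graph_iso G (path_graph 3).
Proof.
move=> [_ conG] ab va vb la lb /subsetP nv.
have av : adj a v by rewrite adj_sym.
have bv : adj b v by rewrite adj_sym.
have neq_va : v != a by apply: contraTneq va => <-; rewrite adj_irrefl.
have neq_vb : v != b by apply: contraTneq vb => <-; rewrite adj_irrefl.
have adj_ab : adj a b = false.
  by apply/negP => /(leaf_neigh_uniq la av) e; rewrite e eqxx in neq_vb.
have all3 x : x \in [:: a; v; b].
  have cl : closed (@adj G) [in [:: a; v; b]].
    apply: intro_closed => [|y z yz].
      exact: (sym_connect_sym (@adj_sym G)).
    rewrite !inE => /or3P[] /eqP Ey; subst y.
    - by rewrite (leaf_neigh_uniq la yz av) eqxx orbT.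
    - by have := nv z; rewrite !inE yz => /(_ isT)/orP[]->; rewrite ?orbT.
    - by rewrite (leaf_neigh_uniq lb yz bv) eqxx orbT.
  by rewrite -(closed_connect cl (conG v x)) !inE eqxx orbT.
have idx x : index x [:: a; v; b] < 3 by rewrite index_mem all3.
exists (fun x => Ordinal (idx x) : path_graph 3).
  exists (fun i : path_graph 3 => nth v [:: a; v; b] (i : 'I_3)) => [x|i].
    by rewrite nth_index.
  apply/val_inj/index_uniq; first exact: ltn_ord.
  by rewrite /= !inE negb_or ab eq_sym neq_va neq_vb.
have E : (a == v = false) * (v == a = false) * (b == v = false) *
         (v == b = false) * (a == b = false) * (b == a = false).
  by do !split; apply/negbTE; rewrite // eq_sym.
move=> x y; move: (all3 x) (all3 y); pose s := [:: a; v; b].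
rewrite -[LHS]/(((index x s).+1 == index y s) || ((index y s).+1 == index x s)).
rewrite !inE => /or3P[] /eqP-> /or3P[] /eqP->;
  by rewrite /= !(E, eqxx) /= ?adj_irrefl ?va ?vb ?av ?bv ?adj_ab // adj_sym.
Qed.

Lemma semiexcellent12_no_strong_support (G : sgraph) :
    connected G -> ~ graph_iso G (path_graph 3) -> semiexcellent12 G ->
  forall v : G, ~~ strong_support v.
Proof.
move=> conG notP3 exG v; apply/negP.
move=> /card_gt1P[a [b [+ + ab]]]; rewrite !inE => /andP[va la] /andP[vb lb].
have [nv|/subsetPn[w]] := boolP (neigh v \subset [set a; b]).
  exact: notP3 (path3_of_two_leaves conG ab va vb la lb nv).
rewrite !inE negb_or => vw /andP[wa wb].
have [S [indS domS] wS] := exG w.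
have vNS : v \notin S by apply: contraL vw => vS; apply: indS.
have leafS x : adj v x -> leaf x -> x \in S.
  move=> vx lx; apply: contraT => /domS/andP[/card_gt0P[y]].
  rewrite !inE => /andP[xy yS] _.
  by rewrite (leaf_neigh_uniq lx xy (y := v)) 1?adj_sym ?(negPf vNS) in yS.
have /andP[_] := domS v vNS; rewrite leqNgt => /negP[].
apply/card_gt2P; exists a, b, w; rewrite !inE va vb vw wS !leafS //.
by do !split; rewrite // eq_sym.
Qed.

(** Minimal walk length from [r] serves as [d]. *)
Lemma connected_depth (G : sgraph) (r : G) :
    connected G ->
  exists d : G -> nat,
    forall u, u != r -> exists2 w, adj u w & d u = (d w).+1.
Proof.
move=> [_ conG].
pose walk n u := [exists q : n.-tuple G, path (@adj G) r q && (last r q == u)].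
have walkP n u : reflect
    (exists q, [/\ size q = n, path (@adj G) r q & last r q = u]) (walk n u).
  apply: (iffP existsP) => [[q /andP[pq /eqP lq]]|[q [sq pq lq]]].
    by exists q; rewrite size_tuple.
  by move/eqP: sq => sq; exists (Tuple sq); rewrite /= pq lq eqxx.
have exwalk u : exists n, walk n u.
  have /connectP[q pq lq] := conG r u.
  by exists (size q); apply/walkP; exists q.
exists (fun u => ex_minn (exwalk u)) => u ur.
case: ex_minnP => n /walkP[q [sq pq lq]] min_n.
case/lastP: q => [|q z] in sq pq lq *; first by rewrite -lq eqxx in ur.
rewrite last_rcons in lq; subst z; move: pq; rewrite rcons_path => /andP[pq qu].
exists (last r q); first by rewrite adj_sym.
case: ex_minnP => m /walkP[q' [sq' pq' lq']] min_m.
apply/eqP; rewrite eqn_leq; apply/andP; split.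
  apply: min_n; apply/walkP; exists (rcons q' u).
  by rewrite size_rcons sq' rcons_path pq' lq' last_rcons.
by rewrite -sq size_rcons ltnS; apply: min_m; apply/walkP; exists q.
Qed.

(** Edges from vertices to their parents already connect everything to the
    root, so any further edge would close a cycle. *)
Lemma tree_parent (G : sgraph) (r : G) :
    tree G ->
  exists (p : G -> G) (d : G -> nat),
    (forall u, u != r -> adj u (p u) /\ d u = (d (p u)).+1) /\
    (forall x y, adj x y -> (x != r /\ p x = y) \/ (y != r /\ p y = x)).
Proof.
move=> [conG acG]; have [d dP] := connected_depth r conG.
have [u|p pP] := @fin_all_exists G (fun=> G)
    (fun u w => u != r -> adj u w /\ d u = (d w).+1).
  by have [->|/dP[w uw duw]] := eqVneq u r; [exists r | exists w].
exists p, d; split=> // x y xy.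
pose e := [rel x y : G | (x != r) && (p x == y) || (y != r) && (p y == x)].
have e_adj : subrel e (@adj G).
  move=> a b /orP[]/andP[/pP[ap _] /eqP<-] //.
  by rewrite adj_sym.
have e_sym : connect_sym e by apply: sym_connect_sym => a b; rewrite /= orbC.
have to_root u : connect e u r.
  have [n] := ubnP (d u); elim: n u => // n IHn u; rewrite ltnS => du.
  have [->|ur] := eqVneq u r; first exact: connect0.
  have [_ dpu] := pP u ur.
  apply: connect_trans (IHn (p u) _); last by rewrite -dpu.
  by apply: connect1; rewrite /= ur eqxx.
have [|Ne] := boolP (e x y).
  by move=> /orP[]/andP[nr /eqP <-]; [left | right].
have : connect e x y by apply: connect_trans (to_root x) _; rewrite e_sym.
move=> /connectP[q0 /shortenP[q pq uq _] lq].
suff: false by [].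
case: (acG (x :: q)); last first.
  rewrite /ucycle uq andbT /= rcons_path (sub_path e_adj) //=.
  by rewrite -lq adj_sym.
case: q => [|z [|z' q]] // in pq uq lq *.
  by rewrite lq /= adj_irrefl in xy.
by move: pq Ne; rewrite lq /= => /andP[->].
Qed.

(** Membership is computed by recursion on [d], a bound on the number of steps
    that iterating [p] takes to reach [r]. *)
Lemma parent_recursion (V : finType) (r : V) (p : V -> V) (d : V -> nat)
    (sel : pred V) :
    (forall u, u != r -> d u = (d (p u)).+1) ->
  exists2 S : {set V}, r \in S &
    forall u, u != r -> (u \in S) = (p u \notin S) && sel u.
Proof.
move=> dP.
pose f := fix f n u := (u == r) ||
  (if n is m.+1 then ~~ f m (p u) && sel u else true).
exists [set u | f (d u) u].
  by rewrite inE; case: (d r) => *; rewrite /= eqxx.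
by move=> u ur; rewrite !inE dP //= (negPf ur).
Qed.

Lemma no_strong_support_semiexcellent12 (G : sgraph) :
    tree G -> (forall v : G, ~~ strong_support v) -> semiexcellent12 G.
Proof.
move=> treeG noss r; have [p [d [pP edgeP]]] := tree_parent r treeG.
pose child u := [pred w | (w != r) && (p w == u)].
(* The selected child; the default [u] arises only when [u] has no child. *)
pose c u := odflt (odflt u [pick w | child u w])
                  [pick w | child u w && leaf w].
have c_child u w : child u w -> child u (c u).
  move=> uw; rewrite /c; case: pickP => [y uy|/(_ w)/negP/(_ uw)//] /=.
  by case: pickP => [x /andP[]|].
have c_leaf u : u != r -> leaf u -> c (p u) = u.
  move=> ur lu; have [up _] := pP u ur.
  rewrite /c; case: (pickP (fun w => _ && leaf w)) => [x|/(_ u)]; last first.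
    by rewrite /= ur eqxx lu.
  move=> /andP[/andP[/pP[xp _] /eqP px] lx] /=.
  by apply: (not_strong_support_leaf_uniq (noss (p u))) => //;
     rewrite adj_sym // -px.
have [u /pP[]//|S rS SE] :=
  @parent_recursion G r p d [pred u | u == c (p u)].
exists S => //; split=> [x y xS yS|u uS].
  apply/negP => /edgeP[] [nr E].
    by move: xS; rewrite SE // E yS.
  by move: yS; rewrite SE // E xS.
have ur : u != r by apply: contraNneq uS => ->.
have [up _] := pP u ur.
apply/andP; split; last first.
  suff sub : neigh u :&: S \subset [set p u; c u].
    by rewrite (leq_trans (subset_leq_card sub)) // cards2; case: eqP.
  apply/subsetP => w; rewrite !inE => /andP[/edgeP[] [nr <-]].
    by rewrite eqxx.
  by rewrite SE // => /andP[_ /eqP <-]; rewrite eqxx orbT.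
apply/card_gt0P; have [lu|Nlu] := boolP (leaf u).
  exists (p u); rewrite !inE up /=.
  by move: uS; rewrite SE //= c_leaf // eqxx andbT negbK.
have [w uw wp] : exists2 w, adj u w & w != p u.
  apply/exists_inP; apply: contraR Nlu => /exists_inPn nw.
  apply/cards1P; exists (p u); apply/setP => w; rewrite !inE.
  have [->//|wp] := eqVneq w (p u).
  by apply/negbTE; apply: contra wp => /nw; rewrite negbK.
have /c_child/andP[cr /eqP pc] : child u w.
  have [[_ E]|[wr E]] := edgeP u w uw; first by rewrite E eqxx in wp.
  by rewrite /= wr E eqxx.
exists (c u); rewrite !inE SE //= pc uS eqxx andbT.
by have [+ _] := pP _ cr; rewrite pc adj_sym => ->.
Qed.

Theorem theorem3 (T : sgraph) (treeT : tree T)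
    (T_not_P3 : ~ graph_iso T (path_graph 3)) :
  semiexcellent12 T <-> ~ (exists v : T, strong_support v).
Proof.
split=> [exT [v ssv]|noss].
  have [conT _] := treeT.
  by have := semiexcellent12_no_strong_support conT T_not_P3 exT v; rewrite ssv.
apply: no_strong_support_semiexcellent12 => // v.
by apply/negP => ssv; apply: noss; exists v.
Qed.
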